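(* Let $p\in(1,\infty)$. There exist positive constants $\mu_p$ and $L_p$ depending on $p$ such that, for any $u,v\in W^{1,p}(\Omega)$, $$\mu_p\|u-v\|_{(\nabla v)}^2\le D_F(u,v)\le L_p\|u-v\|_{(\nabla v)}^2.$$
   Context: $\Omega\subset\mathbb{R}^2$ is a bounded polygonal domain with Lipschitz boundary, $1/p+1/p^*=1$, $f\in L^{p^*}(\Omega)$, and $F(v)=\frac1p\int_\Omega|\nabla v|^p\,dx-\int_\Omega fv\,dx$ for $v\in W^{1,p}(\Omega)$. Its derivative is $\langle F'(v),w\rangle=\int_\Omega|\nabla v|^{p-2}\nabla v\cdot\nabla w\,dx-\int_\Omega fw\,dx$. The Bregman distance is $D_F(u,v)=F(u)-F(v)-\langle F'(v),u-v\rangle$. The quasi-norm is $\|w\|_{(\nabla v)}^2=\int_\Omega(|\nabla w|+|\nabla v|)^{p-2}|\nabla w|^2\,dx$ for $v,w\in W^{1,p}(\Omega)$, where the integrand is read as $0$ where $\nabla w=\nabla v=0$. *)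

(* Defs.v *)
From HB Require Import structures.
From mathcomp Require Import all_boot all_order all_algebra.
From mathcomp Require Import all_classical all_reals all_analysis.
From mathcomp Require Import measurable_realfun lra.

Set Implicit Arguments.
Unset Strict Implicit.
Unset Printing Implicit Defensive.

Import Order.TTheory GRing.Theory Num.Theory.
Import numFieldNormedType.Exports.

Local Open Scope classical_set_scope.
Local Open Scope ring_scope.

Section Plane.
Context {R : realType}.
Implicit Types (x y : R * R) (Omega : set (R * R)).

Definition dotp x y : R := x.1 * y.1 + x.2 * y.2.

(* The library norm on R * R is the max norm, hence this definition. *)
Definition enorm x : R := Num.sqrt (dotp x x).

Definition leb2 := (@lebesgue_measure R \x @lebesgue_measure R)%E.

Definition segment x y : set (R * R) :=
  [set (1 - t) *: x + t *: y | t in `[0, 1]].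

Definition boundary Omega : set (R * R) := closure Omega `\` Omega°.

Definition polygonal_boundary Omega :=
  exists s : seq ((R * R) * (R * R)),
    boundary Omega = \bigcup_(ab in [set` s]) segment ab.1 ab.2.

(* e and its rotation by a right angle form an orthonormal frame; near x the
   set Omega is the strict epigraph of gamma in the coordinates of this frame. *)
Definition lipschitz_boundary Omega :=
  forall x, boundary Omega x ->
    exists (e : R * R) (k : R) (gamma : R -> R),
      [/\ dotp e e = 1, k.-lipschitz gamma &
        \forall z \near x,
          Omega z <-> gamma (dotp z e) < dotp z (- e.2, e.1)].

Definition polygonal_lipschitz_domain Omega :=
  [/\ open Omega, connected Omega, Omega !=set0 & bounded_set Omega]
  /\ polygonal_boundary Omega /\ lipschitz_boundary Omega.

(* The extension of g by zero outside Omega is in the library's L^p space. *)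
Definition in_Lp (p : R) Omega (g : R * R -> R) : Prop :=
  g \_ Omega \in Lfun leb2 p%:E.

Definition dirx : R * R := (1, 0).
Definition diry : R * R := (0, 1).

Fixpoint Ck (n : nat) (phi : R * R -> R) : Prop :=
  continuous phi /\
  if n is m.+1 then
    [/\ forall z, derivable phi z dirx, forall z, derivable phi z diry,
        Ck m (fun z => 'D_dirx phi z) & Ck m (fun z => 'D_diry phi z)]
  else True.

Definition test_function Omega (phi : R * R -> R) : Prop :=
  let supp := closure [set z | phi z != 0] in
  [/\ forall n, Ck n phi, compact supp & supp `<=` Omega].

Definition weak_derivative Omega (e : R * R) (v g : R * R -> R) : Prop :=
  forall phi, test_function Omega phi ->
    \int[leb2]_(z in Omega) (v z * 'D_e phi z) =
    - \int[leb2]_(z in Omega) (g z * phi z).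

(* A Sobolev function is given together with its weak gradient (unique up to a
   null set): v is v.1 and its gradient is v.2. The group operations of this
   product type are the pointwise ones, on the function and on the gradient;
   W1pB below shows that they preserve W1p. *)
Definition fun_grad : Type := ((R * R -> R) * (R * R -> R * R))%type.
HB.instance Definition _ := GRing.Zmodule.on fun_grad.

Definition grad (v : fun_grad) : R * R -> R * R := v.2.

Definition W1p (p : R) Omega : set fun_grad :=
  [set v | [/\ in_Lp p Omega v.1,
               in_Lp p Omega (fun z => (grad v z).1),
               in_Lp p Omega (fun z => (grad v z).2),
               weak_derivative Omega dirx v.1 (fun z => (grad v z).1) &
               weak_derivative Omega diry v.1 (fun z => (grad v z).2)]].

Section Energy.
Variables (p : R) (Omega : set (R * R)) (f : R * R -> R).
Implicit Types u v w : fun_grad.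

Definition energy v : R :=
  p^-1 * \int[leb2]_(z in Omega) (enorm (grad v z) `^ p)
  - \int[leb2]_(z in Omega) (f z * v.1 z).

Definition energy_derivative v w : R :=
  \int[leb2]_(z in Omega)
     (enorm (grad v z) `^ (p - 2) * dotp (grad v z) (grad w z))
  - \int[leb2]_(z in Omega) (f z * w.1 z).

Definition bregman u v : R :=
  energy u - energy v - energy_derivative v (u - v).

(* powR at base 0 is 0 or 1, so the integrands here and in energy_derivative
   vanish where the gradients do, for every p. *)
Definition quasi_norm2 v w : R :=
  \int[leb2]_(z in Omega)
     ((enorm (grad w z) + enorm (grad v z)) `^ (p - 2) * enorm (grad w z) ^+ 2).

End Energy.

Lemma measurable_ball2 (q : R * R) (r : R) :
  measurable (ball q r : set (measurableTypeR R * measurableTypeR R)).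
Proof.
have -> : ball q r = ball q.1 r `*` ball q.2 r by [].
by apply: measurableX; exact: measurable_ball.
Qed.

Lemma open_measurable2 (U : set (R * R)) : open U ->
  measurable (U : set (measurableTypeR R * measurableTypeR R)).
Proof.
move=> oU.
pose B (i : rat * rat * nat) : set (R * R) :=
  ball ((ratr i.1.1, ratr i.1.2) : R * R) (i.2.+1%:R^-1).
have -> : U = \bigcup_i (if `[< B i `<=` U >] then B i else set0).
  apply/seteqP; split => [x Ux|x [i _]]; last by case: ifP => // /asboolP BU /BU.
  have /nbhs_ballP[e /= e0 xeU] : nbhs x U by exact: open_nbhs_nbhs.
  have e20 : 0 < e / 2 by rewrite divr_gt0.
  have [n _ /(_ n (leqnn n)) /= ne] := near_infty_natSinv_lt (PosNum e20).
  have n0 : 0 < (n.+1%:R^-1 : R) by rewrite invr_gt0.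
  have ratball (y : R) : exists q : rat, ball (ratr q : R) n.+1%:R^-1 y.
    move: n0; move: (n.+1%:R^-1 : R) => d d0.
    have : y - d < y + d by lra.
    move=> /rat_in_itvoo[q]; rewrite in_itv/= => /andP[q1 q2]; exists q.
    by rewrite /ball/= ltr_norml; apply/andP; split; move: q1 q2; lra.
  have [q1 xq1] := ratball x.1; have [q2 xq2] := ratball x.2.
  exists (q1, q2, n) => //.
  rewrite asboolT; first by split.
  move=> y; case=> /= yq1 yq2; apply: xeU.
  have bb (a b q : R) : ball q n.+1%:R^-1 a -> ball q n.+1%:R^-1 b -> ball a e b.
    move=> aq bq; rewrite (splitr e).
    apply: (@ball_triangle _ _ q); last exact: le_ball (ltW ne) _ bq.
    by apply: ball_sym; exact: le_ball (ltW ne) _ aq.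
  by split => /=; [exact: bb xq1 yq1|exact: bb xq2 yq2].
apply: countable_bigcupT_measurable => // i.
by case: ifP => _; [exact: measurable_ball2|exact: measurable0].
Qed.

Lemma continuous_measurable2 (psi : R * R -> R) : continuous psi ->
  measurable_fun [set: measurableTypeR R * measurableTypeR R] psi.
Proof.
move=> /continuousP cpsi.
apply: (measurability _ (RGenOInfty.measurableE R)) => _ [_ [a ->] <-].
rewrite setTI; apply: open_measurable2; apply: cpsi; exact: interval_open.
Qed.

Lemma bounded_leb2 Omega : open Omega -> bounded_set Omega -> (leb2 Omega < +oo)%E.
Proof.
move=> oO [M [_ /(_ (Num.max M 0 + 1))]].
have -> : M < Num.max M 0 + 1 by rewrite ltr_pwDr// le_max lexx.
move=> /(_ isT) OM; set m := Num.max M 0 + 1 in OM *.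
have m0 : 0 < m by rewrite ltr_pwDr// le_max lexx orbT.
pose I : set (measurableTypeR R) := `[- m, m]%classic.
have /le_lt_trans : (leb2 Omega <= leb2 (I `*` I))%E.
  apply: le_measure; rewrite ?inE.
  - exact: open_measurable2.
  - by apply: measurableX; exact: measurable_itv.
  - move=> x /OM /=; rewrite prod_normE/= ge_max !ler_norml => /andP[? ?].
    by split; rewrite /I /= in_itv /=.
apply.
rewrite /leb2 product_measure1E//; [|exact: measurable_itv..].
have lI : (@lebesgue_measure R I < +oo)%E.
  by rewrite /I lebesgue_measure_itv/=; case: ifP => _; rewrite ?ltry// -EFinD ltry.
by apply: lte_mul_pinfty => //; rewrite ge0_fin_numE.
Qed.

Lemma integrable_Lp_mul p Omega (v psi : R * R -> R) (M : R) :
  1 <= p -> open Omega -> bounded_set Omega -> in_Lp p Omega v ->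
  continuous psi -> (forall z, `|psi z| <= M) ->
  leb2.-integrable Omega (EFin \o (fun z => v z * psi z)).
Proof.
move=> p1 oO bO vp cpsi psiM.
have mO := open_measurable2 oO.
have M0 : 0 <= M by exact: le_trans (psiM 0).
have mv : measurable_fun (Omega : set (measurableTypeR R * measurableTypeR R)) v.
  apply/(measurable_restrictT _ _).2 => //.
  by have := sub_Lfun_mfun vp; rewrite inE.
have iv : leb2.-integrable Omega (fun z => (M * (1 + `|v z| `^ p))%:E).
  under eq_fun do rewrite EFinM; apply: integrableZl => //.
  under eq_fun do rewrite EFinD; apply: integrableD => //.
    apply: (@measurable_bounded_integrable _ _ _ leb2 (fun=> 1) _ mO) => //.
    - exact: bounded_leb2.
    - by exists 1; split => // x x1 y _ /=; rewrite normr1; exact: ltW.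
  apply/integrable_mkcond => //.
  have := Lfun_integrable p1 vp; apply: eq_integrable => // z _.
  rewrite !patchE; case: ifPn => // _.
  by rewrite normr0 powR0// gt_eqF// (lt_le_trans ltr01).
apply: le_integrable iv => //.
  apply/measurable_EFinP; apply: measurable_funM => //.
  exact: measurable_funS (continuous_measurable2 cpsi).
move=> z _ /=; rewrite lee_fin normrM mulrC.
have h : `|v z| <= 1 + `|v z| `^ p.
  have [v1|v1] := leP `|v z| 1; first by rewrite (le_trans v1)// lerDl powR_ge0.
  rewrite (@le_trans _ _ (`|v z| `^ p))//; last by rewrite lerDr.
  by rewrite -[leLHS]powRr1// ler_powR// ltW.
rewrite [leRHS]ger0_norm ?mulr_ge0// ?addr_ge0// ?powR_ge0//.
exact: ler_pM.
Qed.

Lemma compact_support_bounded (K : set (R * R)) (psi : R * R -> R) :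
  compact K -> continuous psi -> (forall z, ~ K z -> psi z = 0) ->
  exists M, forall z, `|psi z| <= M.
Proof.
move=> cK cpsi K0.
have /compact_bounded[M [_ /(_ (Num.max M 0 + 1))]] : compact (psi @` K).
  by apply: continuous_compact => //; exact: continuous_subspaceT.
have -> : M < Num.max M 0 + 1 by rewrite ltr_pwDr// le_max lexx.
move=> /(_ isT) KM; exists (Num.max M 0 + 1) => z.
have [Kz|/K0 ->] := pselect (K z); first by apply: KM; exists z.
by rewrite normr0 addr_ge0// le_max lexx orbT.
Qed.

Lemma test_function_bounded Omega (e : R * R) (phi : R * R -> R) :
  e = dirx \/ e = diry -> test_function Omega phi ->
  [/\ continuous phi, continuous (fun z => 'D_e phi z),
      exists M, forall z, `|phi z| <= M &
      exists M, forall z, `|'D_e phi z| <= M].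
Proof.
move=> exy [sm cK KO]; set K := closure _ in cK KO.
have phi0 z : ~ K z -> phi z = 0.
  by move=> nKz; apply/eqP/negP => /negP z0; apply: nKz; exact: subset_closure.
have cphi : continuous phi by have [] := sm 0%N.
have cD : continuous (fun z => 'D_e phi z).
  by have [_ [_ _ [cx _] [cy _]]] := sm 1%N; case: exy => ->.
split => //; first exact: compact_support_bounded phi0.
apply: (compact_support_bounded cK cD) => z nKz.
rewrite (@near_eq_derive _ _ _ _ (cst 0)) ?derive_cst//.
have : nbhs z (~` K).
  by apply: open_nbhs_nbhs; split => //; apply: closed_openC; exact: closed_closure.
by apply: filterS => y; exact: phi0.
Qed.

Lemma in_LpB p Omega (f g : R * R -> R) : 1 <= p ->
  in_Lp p Omega f -> in_Lp p Omega g -> in_Lp p Omega (f \- g).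
Proof.
move=> p1 fp gp; rewrite /in_Lp.
have -> : (f \- g) \_ Omega = f \_ Omega + - (g \_ Omega).
  by apply/funext => z; rewrite !fctE /= !patchE; case: ifP => //; rewrite subr0.
apply: (Lfun_addr_closed _ _).2 => //.
exact: Lfun_oppr_closed.
Qed.

Lemma weak_derivativeB p Omega (e : R * R) (u v gu gv : R * R -> R) :
  1 <= p -> open Omega -> bounded_set Omega -> e = dirx \/ e = diry ->
  in_Lp p Omega u -> in_Lp p Omega v -> in_Lp p Omega gu -> in_Lp p Omega gv ->
  weak_derivative Omega e u gu -> weak_derivative Omega e v gv ->
  weak_derivative Omega e (u \- v) (gu \- gv).
Proof.
move=> p1 oO bO exy up vp gup gvp wu wv phi tphi.
have [cphi cD [M phiM] [N DN]] := test_function_bounded exy tphi.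
have mO := open_measurable2 oO.
have iP w : in_Lp p Omega w ->
    leb2.-integrable Omega (EFin \o (fun z => w z * phi z)).
  by move=> wp; exact: (integrable_Lp_mul p1 oO bO wp cphi phiM).
have iD w : in_Lp p Omega w ->
    leb2.-integrable Omega (EFin \o (fun z => w z * 'D_e phi z)).
  by move=> wp; exact: (integrable_Lp_mul p1 oO bO wp cD DN).
under eq_Rintegral do rewrite mulrBl.
under [in RHS]eq_Rintegral do rewrite mulrBl.
rewrite (RintegralB mO (iD _ up) (iD _ vp)) (RintegralB mO (iP _ gup) (iP _ gvp)).
by rewrite wu// wv// opprB opprK addrC.
Qed.

Lemma W1pB p Omega (u v : fun_grad) :
  1 <= p -> open Omega -> bounded_set Omega ->
  W1p p Omega u -> W1p p Omega v -> W1p p Omega (u - v).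
Proof.
move=> p1 oO bO [u0 ux uy wux wuy] [v0 vx vy wvx wvy]; split.
- exact: in_LpB.
- exact: in_LpB ux vx.
- exact: in_LpB uy vy.
- by apply: (weak_derivativeB p1 oO bO _ u0 v0 ux vx wux wvx); left.
- by apply: (weak_derivativeB p1 oO bO _ u0 v0 uy vy wuy wvy); right.
Qed.

End Plane.

Arguments fun_grad : clear implicits.

(* Main.v *)
(* The Bregman distance is the integral of the pointwise Bregman distance of
   |.|^p / p at the gradients a of u and b of v. With s = |a|, t = |b| and
   k = |a||b| - a.b, the latter is d(s, t) + t^(p-2) k, where
   d(s, t) = s^p/p + (1 - 1/p) t^p - t^(p-1) s is the Bregman distance of the
   scalar function, whereas |a - b|^2 = (s - t)^2 + 2 k, and |a - b| + |b| is
   comparable with s + t. By Young's inequality d is nonnegative, so that its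
   symmetrization and its three-point identity at the midpoint m of s and t give
     (m^(p-1) - t^(p-1)) (m - t) <= d(s, t) <= (s^(p-1) - t^(p-1)) (s - t);
   Bernoulli's inequality shows that both sides are comparable with
   (s + t)^(p-2) (s - t)^2. The term in k is handled by the comparison of t with
   s + t if s <= 2 t, and otherwise it is absorbed since k <= 2 s t <= 4 (s - t)^2. *)
Require Import Defs.
From HB Require Import structures.
From mathcomp Require Import all_boot all_order all_algebra.
From mathcomp Require Import all_classical all_reals all_analysis.
From mathcomp Require Import measurable_realfun ring lra.
Import Order.TTheory GRing.Theory Num.Theory.
Import numFieldNormedType.Exports.
Local Open Scope classical_set_scope.
Local Open Scope ring_scope.

Set Implicit Arguments.
Unset Strict Implicit.

(** * Bernoulli's inequality and differences of powers *)

(** Young's inequality for x and 1 with exponents q and q / (q - 1); the case q = 1, where the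
    second exponent degenerates, is separate. *)
Lemma powR_bernoulli (R : realType) (q x : R) :
  1 <= q -> 0 <= x -> q * x - (q - 1) <= x `^ q.
Proof.
move=> q1 x0; have [->|q1'] := eqVneq q 1; first by rewrite powRr1//; lra.
have {q1'} q1 : 1 < q by rewrite lt_neqAle eq_sym q1'.
have q0 : 0 < q by lra.
have qB : 0 < q - 1 by lra.
have := @conjugate_powR R x 1 q (q / (q - 1)) x0 ler01 q0 (divr_gt0 q0 qB).
rewrite invf_div mulr1 powR1 mul1r => /(_ _)/wrap[].
  by field; rewrite gt_eqF.
rewrite -(ler_pM2r q0) mulrDl !divfK ?gt_eqF// => h.
by rewrite lerBlDr mulrC.
Qed.

(** For q >= 1, Bernoulli gives the upper bound and x^q <= x the lower one. For q < 1, Bernoulli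
    with exponent 1/q at x^q gives the lower bound and x <= x^q the upper one. *)
Lemma onem_powR_bounds (R : realType) (q x : R) :
  0 < q -> 0 <= x -> x <= 1 ->
  Num.min 1 q * (1 - x) <= 1 - x `^ q <= Num.max 1 q * (1 - x).
Proof.
move=> q0 x0 x1; have [q1|q1] := leP 1 q.
  have := powR_bernoulli q1 x0.
  have : x `^ q <= x.
    have [->|xn0] := eqVneq x 0; first by rewrite powR0 ?gt_eqF.
    by apply: ge1r_powR => //; rewrite lt_neqAle eq_sym xn0 x0.
  by move=> ? ?; apply/andP; split; nra.
have qV1 : 1 <= q^-1 by rewrite invf_ge1// ltW.
have := powR_bernoulli qV1 (powR_ge0 x q).
rewrite -powRrM mulfV ?gt_eqF// powRr1//.
move=> /(ler_wpM2l (ltW q0)).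
have -> : q * (q^-1 * x `^ q - (q^-1 - 1)) = x `^ q - 1 + q.
  by field; rewrite gt_eqF.
have : x <= x `^ q.
  have [->|xn0] := eqVneq x 0; first exact: powR_ge0.
  by apply: ger1_powR; [rewrite lt_neqAle eq_sym xn0 x0|exact: ltW].
by move=> ? ?; apply/andP; split; lra.
Qed.

(** By homogeneity this is the previous estimate at x = b / a, multiplied by a^q. *)
Lemma powR_sub_bounds (R : realType) (q a b : R) :
  0 < q -> 0 <= b -> b <= a -> 0 < a ->
  Num.min 1 q * (a `^ (q - 1) * (a - b)) <= a `^ q - b `^ q
    <= Num.max 1 q * (a `^ (q - 1) * (a - b)).
Proof.
move=> q0 b0 ba a0.
have x0 : 0 <= b / a by rewrite divr_ge0// ltW.
have x1 : b / a <= 1 by rewrite ler_pdivrMr ?mul1r.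
have /andP[h1 h2] := onem_powR_bounds q0 x0 x1.
have aq : 0 < a `^ q by exact: powR_gt0.
have -> : a `^ q - b `^ q = a `^ q * (1 - (b / a) `^ q).
  by rewrite mulrBr mulr1 -powRM ?(ltW a0)// mulrC divfK ?gt_eqF.
have -> : a `^ (q - 1) * (a - b) = a `^ q * (1 - b / a).
  by rewrite -(mulr_powRB1 (ltW a0) q0); field; rewrite gt_eqF.
by rewrite !(mulrCA _ (a `^ q)) !ler_pM2l// h1 h2.
Qed.

(** The exponent may have either sign: x <= K y serves e >= 0, and y <= K x serves e < 0. *)
Lemma le_powR_comparable (R : realType) (K e x y : R) :
  1 <= K -> 0 < x -> 0 < y -> x <= K * y -> y <= K * x ->
  x `^ e <= K `^ `|e| * y `^ e.
Proof.
move=> K1 x0 y0 xy yx; have K0 : 0 <= K by lra.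
have [e0|e0] := leP 0 e.
  rewrite ger0_norm// -powRM ?(ltW y0)//.
  by apply: ge0_ler_powR => //; rewrite nnegrE ?mulr_ge0// ltW.
rewrite ltr0_norm// -[e in x `^ e]opprK -[e in y `^ e]opprK !(powRN _ (- e)).
rewrite -ler_pdivrMr ?invr_gt0 ?powR_gt0// invrK ler_pdivrMl ?powR_gt0//.
rewrite mulrC -powRM ?(ltW x0)//.
by apply: ge0_ler_powR; rewrite ?nnegrE ?mulr_ge0 ?oppr_ge0// ltW.
Qed.

(** The products are symmetric in a and b, so b <= a may be assumed. Then a <= w <= 2 a, and
    replacing a^(q-1) by w^(q-1) costs the factor 2^|q-1|. *)
Lemma powR_monotone_bounds (R : realType) (q a b w : R) :
  0 < q -> 0 <= a -> 0 <= b -> 0 < w ->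
  a <= w -> b <= w -> w <= 2 * Num.max a b ->
  Num.min 1 q * w `^ (q - 1) * (a - b) ^+ 2
    <= 2 `^ `|q - 1| * ((a `^ q - b `^ q) * (a - b)) /\
  (a `^ q - b `^ q) * (a - b)
    <= Num.max 1 q * 2 `^ `|q - 1| * w `^ (q - 1) * (a - b) ^+ 2.
Proof.
move=> q0; wlog ba : a b / b <= a.
  move=> H a0 b0 w0 aw bw wab; have [/H|/ltW/H] := leP b a; first exact.
  by rewrite maxC -[(b - a) ^+ 2]sqrrN opprB -[_ * (b - a)]mulrNN !opprB; apply.
move=> a0 b0 w0 aw _; rewrite (max_idPl ba) => wa.
have {}a0 : 0 < a by lra.
have /andP[lo hi] := powR_sub_bounds q0 b0 ba a0.
have aw' : a <= 2 * w by lra.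
have wE := le_powR_comparable (q - 1) (ler1n _ 2) w0 a0 wa aw'.
have aE := le_powR_comparable (q - 1) (ler1n _ 2) a0 w0 aw' wa.
have m0 : 0 < Num.min 1 q by rewrite lt_min ltr01 q0.
have M0 : 0 < Num.max 1 q by rewrite lt_max ltr01.
have d0 : 0 <= a - b by rewrite subr_ge0.
have d20 : 0 <= (a - b) ^+ 2 by exact: sqr_ge0.
have E0 : 0 <= 2 `^ `|q - 1| :> R by exact: powR_ge0.
split.
  apply: (@le_trans _ _ (Num.min 1 q * (2 `^ `|q - 1| * a `^ (q - 1)) * (a - b) ^+ 2)).
    by rewrite ler_wpM2r// ler_wpM2l// ltW.
  have := ler_wpM2l E0 (ler_wpM2r d0 lo).
  by apply: le_trans; rewrite le_eqVlt; apply/orP; left; apply/eqP; ring.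
apply: le_trans (ler_wpM2r d0 hi) _.
have := ler_wpM2l (ltW M0) (ler_wpM2r d20 aE).
by rewrite expr2 !mulrA.
Qed.

(** * The scalar Bregman distance *)

(** This is s^p/p - t^p/p - t^(p-1) (s - t), with t^(p-1) t collected into t^p. *)
Definition powR_gap (R : realType) (p s t : R) : R :=
  s `^ p / p + (1 - p^-1) * t `^ p - t `^ (p - 1) * s.

(** Young's inequality for s and t^(p-1) with exponents p and p / (p - 1). *)
Lemma powR_gap_ge0 (R : realType) (p s t : R) :
  1 < p -> 0 <= s -> 0 <= t -> 0 <= powR_gap p s t.
Proof.
move=> p1 s0 t0.
have p0 := lt_trans ltr01 p1.
have pB : 0 < p - 1 by lra.
have := @conjugate_powR R s (t `^ (p - 1)) p (p / (p - 1)) s0 (powR_ge0 _ _) p0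
  (divr_gt0 p0 pB).
rewrite -powRrM mulrCA mulfV ?gt_eqF// mulr1 invf_div => /(_ _)/wrap[].
  by field; rewrite gt_eqF.
move=> h; rewrite /powR_gap subr_ge0 mulrC (le_trans h)// lerD2l mulrC.
rewrite le_eqVlt; apply/orP; left; apply/eqP; field.
by rewrite gt_eqF.
Qed.

(** The right-hand side equals d(s, t) + d(t, s), and d(t, s) >= 0. *)
Lemma powR_gap_le (R : realType) (p s t : R) :
  1 < p -> 0 <= s -> 0 <= t ->
  powR_gap p s t <= (s `^ (p - 1) - t `^ (p - 1)) * (s - t).
Proof.
move=> p1 s0 t0; have p0 := lt_trans ltr01 p1.
have := powR_gap_ge0 p1 t0 s0; rewrite -subr_ge0 => h.
rewrite -subr_ge0; apply: le_trans h _; rewrite subr0 /powR_gap -!(mulr_powRB1 _ p0)//.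
rewrite le_eqVlt; apply/orP; left; apply/eqP; field.
by rewrite gt_eqF.
Qed.

(** The three-point identity reads d(s, t) - d(s, m) - d(m, t) = (m^(p-1) - t^(p-1)) (s - m), and s
    - m = m - t at the midpoint. *)
Lemma powR_gap_ge (R : realType) (p s t : R) :
  1 < p -> 0 <= s -> 0 <= t ->
  (((s + t) / 2) `^ (p - 1) - t `^ (p - 1)) * ((s + t) / 2 - t) <= powR_gap p s t.
Proof.
move=> p1 s0 t0; have p0 := lt_trans ltr01 p1.
set m := (s + t) / 2.
have m0 : 0 <= m by rewrite divr_ge0 ?addr_ge0.
have h1 := powR_gap_ge0 p1 s0 m0.
have h2 := powR_gap_ge0 p1 m0 t0.
rewrite -subr_ge0; apply: le_trans (addr_ge0 h1 h2) _.
rewrite /powR_gap -!(mulr_powRB1 _ p0)//.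
move: (s `^ _) (t `^ _) (m `^ _) => A B C; rewrite /m le_eqVlt; apply/orP; left; apply/eqP; field.
by rewrite gt_eqF.
Qed.

(** [powR_monotone_bounds] is used with exponent p - 1 and w = s + t, at the midpoint and t for the
    lower bound and at s and t for the upper one. The factor 4 comes from squaring m - t = (s - t) /
    2. *)
Lemma powR_gap_bounds (R : realType) (p s t : R) :
  1 < p -> 0 <= s -> 0 <= t -> 0 < s + t ->
  Num.min 1 (p - 1) * (s + t) `^ (p - 2) * (s - t) ^+ 2
    <= 4 * 2 `^ `|p - 2| * powR_gap p s t /\
  powR_gap p s t
    <= Num.max 1 (p - 1) * 2 `^ `|p - 2| * (s + t) `^ (p - 2) * (s - t) ^+ 2.
Proof.
move=> p1 s0 t0 st0.
have q0 : 0 < p - 1 by rewrite subr_gt0.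
have -> : p - 2 = p - 1 - 1 by lra.
have E0 : 0 <= 2 `^ `|p - 1 - 1| :> R by exact: powR_ge0.
have m0 : 0 <= (s + t) / 2 by rewrite divr_ge0 ?addr_ge0.
split.
  have [] := powR_monotone_bounds q0 m0 t0 st0; try lra.
    by have : (s + t) / 2 <= Num.max ((s + t) / 2) t; [rewrite le_max lexx|lra].
  move=> h _.
  have := ler_wpM2l E0 (powR_gap_ge p1 s0 t0).
  move=> /(le_trans h).
  have -> : (s + t) / 2 - t = (s - t) / 2 by field.
  by rewrite expr_div_n; lra.
have [] := powR_monotone_bounds q0 s0 t0 st0; try lra.
  by have [|] := leP s t; lra.
by move=> _; exact/le_trans/powR_gap_le.
Qed.

Lemma powR_bregman_bounds (R : realType) (p : R) : 1 < p ->
  exists mu L : R, [/\ 0 < mu, 0 < L & forall s t k : R,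
    0 <= s -> 0 <= t -> 0 <= k -> k <= 2 * (s * t) -> 0 < s + t ->
    mu * ((s + t) `^ (p - 2) * ((s - t) ^+ 2 + 2 * k))
      <= powR_gap p s t + t `^ (p - 2) * k
      <= L * ((s + t) `^ (p - 2) * ((s - t) ^+ 2 + 2 * k))].
Proof.
move=> p1.
set e := `|p - 2|.
have E1 : 1 <= 3 `^ e :> R.
  by rewrite -[leLHS](powRr0 3) ler_powR ?normr_ge0// ler1n.
have E21 : 2 `^ e <= 3 `^ e :> R.
  by apply: ge0_ler_powR; rewrite ?nnegrE ?normr_ge0// ler_nat.
have E20 : 1 <= 2 `^ e :> R.
  by rewrite -[leLHS](powRr0 2) ler_powR ?normr_ge0// ler1n.
(* The base 3 covers both cases below: s + t <= 3 t if s <= 2 t, and s + t <= 3 s otherwise. *)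
set E := 3 `^ e in E1 E21.
set m := Num.min 1 (p - 1); set M := Num.max 1 (p - 1).
have m0 : 0 < m by rewrite lt_min ltr01 subr_gt0.
have m1 : m <= 1 by rewrite ge_min lexx.
have M0 : 0 < M by rewrite lt_max ltr01.
(* If s > 2 t, then k <= 4 d gives d + 2 k <= 9 d, whence 36 = 9 * 4 with the 4 of [lo']. The
   summand 8 E bounds the term in k in that case, by [h6] and [h8]. *)
exists (m / (36 * E)), (M * E + 8 * E); split.
- by rewrite divr_gt0// mulr_gt0//; lra.
- have E0 := lt_le_trans ltr01 E1; by rewrite addr_gt0// mulr_gt0.
move=> s t k s0 t0 k0 kst st0.
have [lo hi] := powR_gap_bounds p1 s0 t0 st0.
have g0 := powR_gap_ge0 p1 s0 t0.
rewrite -/e -/m -/M in lo hi.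
set W := (s + t) `^ (p - 2) in lo hi *.
have W0 : 0 < W by exact: powR_gt0.
set d := (s - t) ^+ 2 in lo hi *.
have d0 : 0 <= d by exact: sqr_ge0.
set g := powR_gap p s t in lo hi g0 *.
have lo' : m * W * d <= 4 * E * g.
  by apply: (le_trans lo); rewrite ler_wpM2r// ler_wpM2l.
have hi' : g <= M * E * W * d.
  by apply: (le_trans hi); rewrite ler_wpM2r// (ler_wpM2r (ltW W0))// ler_wpM2l// ltW.
have tk0 : 0 <= t `^ (p - 2) * k by rewrite mulr_ge0 ?powR_ge0.
have E0 : 0 < E by lra.
have [ts|ts] := leP s (2 * t).
  have tp : 0 < t by lra.
  have h1 : t `^ (p - 2) <= E * W.
    by apply: le_powR_comparable => //; rewrite ?ler1n//; lra.
  have h2 : W <= E * t `^ (p - 2).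
    by apply: le_powR_comparable => //; rewrite ?ler1n//; lra.
  have h3 := ler_wpM2r k0 h1; have h4 := ler_wpM2r k0 h2.
  apply/andP; split.
    rewrite mulrAC ler_pdivrMr ?mulr_gt0//.
    have h5 : m * (W * k) <= E * t `^ (p - 2) * k.
      rewrite -[leRHS]mul1r; apply: ler_pM => //; first exact: ltW.
      by rewrite mulr_ge0// ltW.
    have : 0 <= E * (t `^ (p - 2) * k) by rewrite mulr_ge0// ltW.
    have : 0 <= E * g by rewrite mulr_ge0// ltW.
    lra.
  have : 0 <= M * E * W * k by do !apply: mulr_ge0 => //; exact: ltW.
  have : 0 <= E * W * d by do !apply: mulr_ge0 => //; exact: ltW.
  have : 0 <= E * W * k by do !apply: mulr_ge0 => //; exact: ltW.
  lra.
have sp : 0 < s by lra.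
have sd : s ^+ 2 <= 4 * d by rewrite /d !expr2; nra.
have kd : k <= 4 * d.
  apply: le_trans sd; apply: (le_trans kst); rewrite expr2 mulrCA.
  by rewrite ler_wpM2l// ltW.
have Wk := ler_wpM2l (ltW W0) kd.
apply/andP; split.
  rewrite mulrAC ler_pdivrMr ?mulr_gt0//.
  have h5 := ler_wpM2l (ltW m0) Wk.
  have : 0 <= E * (t `^ (p - 2) * k) by rewrite mulr_ge0// ltW.
  lra.
(* For p < 2 the factor t^(p-2) is unbounded as t tends to 0. The bound k <= 2 s t supplies a factor
   t, and t^(p-1) <= s^(p-1) since p - 1 > 0. *)
have h6 : t `^ (p - 2) * k <= 2 * s `^ (p - 2) * s ^+ 2.
  have q0 : 0 < p - 1 by rewrite subr_gt0.
  have q2 (x : R) : 0 <= x -> x `^ (p - 1) = x * x `^ (p - 1 - 1).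
    by move=> x0; rewrite mulr_powRB1.
  have eq : p - 2 = p - 1 - 1 by lra.
  apply: (@le_trans _ _ (2 * s * t `^ (p - 1))).
    rewrite q2// -eq; have := ler_wpM2l (powR_ge0 t (p - 2)) kst; lra.
  have -> : 2 * s `^ (p - 2) * s ^+ 2 = 2 * s * s `^ (p - 1).
    by rewrite [in RHS]q2// -eq expr2; ring.
  rewrite ler_wpM2l ?mulr_ge0//.
  by apply: ge0_ler_powR; rewrite ?nnegrE//; lra.
have h7 : s `^ (p - 2) <= E * W.
  by apply: le_powR_comparable => //; rewrite ?ler1n//; lra.
have h8 : 2 * s `^ (p - 2) * s ^+ 2 <= 2 * (E * W) * (4 * d).
  by apply: ler_pM; rewrite ?mulr_ge0 ?powR_ge0 ?sqr_ge0// ler_wpM2l.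
have : 0 <= M * E * W * k by do !apply: mulr_ge0 => //; exact: ltW.
have : 0 <= E * W * k by do !apply: mulr_ge0 => //; exact: ltW.
lra.
Qed.

(** * The Euclidean norm of the plane *)

Section euclidean_norm.
Context {R : realType}.
Implicit Types x y : R * R.

Lemma enorm_ge0 x : 0 <= enorm x.
Proof. exact: sqrtr_ge0. Qed.

Lemma sqr_enorm x : enorm x ^+ 2 = dotp x x.
Proof. by rewrite sqr_sqrtr// /dotp addr_ge0// -expr2 sqr_ge0. Qed.

(** Cauchy-Schwarz from Lagrange's identity: the difference of the squares is (x.1 y.2 - x.2
    y.1)^2. *)
Lemma normr_dotp_le x y : `|dotp x y| <= enorm x * enorm y.
Proof.
rewrite -(@ler_pXn2r _ 2)// ?nnegrE ?mulr_ge0 ?enorm_ge0//.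
rewrite real_normK ?num_real// exprMn !sqr_enorm /dotp -subr_ge0.
by have := sqr_ge0 (x.1 * y.2 - x.2 * y.1); lra.
Qed.

Lemma sqr_enormB x y :
  enorm (x - y) ^+ 2 = enorm x ^+ 2 + enorm y ^+ 2 - 2 * dotp x y.
Proof. by rewrite !sqr_enorm /dotp /=; ring. Qed.

Lemma enormB_le x y : enorm (x - y) <= enorm x + enorm y.
Proof.
rewrite -(@ler_pXn2r _ 2)// ?nnegrE ?addr_ge0 ?enorm_ge0// sqr_enormB.
have := normr_dotp_le x y; rewrite ler_norml => /andP[+ _].
by rewrite !expr2; lra.
Qed.

Lemma enorm_leB x y : enorm x <= enorm (x - y) + enorm y.
Proof.
rewrite -(@ler_pXn2r _ 2)// ?nnegrE ?addr_ge0 ?enorm_ge0//.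
have := normr_dotp_le (x - y) y; rewrite ler_norml => /andP[_].
have := sqr_enormB x y; have := sqr_enorm y.
have -> : dotp (x - y) y = dotp x y - dotp y y by rewrite /dotp /=; ring.
by rewrite !expr2; lra.
Qed.

Lemma enorm_le_add x : enorm x <= `|x.1| + `|x.2|.
Proof.
rewrite -(@ler_pXn2r _ 2)// ?nnegrE ?addr_ge0 ?enorm_ge0// sqr_enorm /dotp.
rewrite sqrrD !real_normK ?num_real// -!expr2.
have : 0 <= `|x.1| * `|x.2| by rewrite mulr_ge0.
lra.
Qed.

End euclidean_norm.

(** * Pointwise bounds at gradients *)

Lemma powR_sub2_mul (R : realType) (p t : R) :
  1 < p -> 0 <= t -> t `^ (p - 2) * t = t `^ (p - 1).
Proof.
move=> p1; rewrite le_eqVlt => /orP[/eqP<-|t0].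
  by rewrite mulr0 powR0// gt_eqF// subr_gt0.
have -> : p - 1 = p - 2 + 1 by lra.
rewrite [RHS]powRD ?powRr1 ?(ltW t0)//.
by apply/implyP => _; rewrite gt_eqF.
Qed.

Lemma powR_sub2_sqr (R : realType) (p t : R) :
  1 < p -> 0 <= t -> t `^ (p - 2) * t ^+ 2 = t `^ p.
Proof.
move=> p1 t0.
by rewrite expr2 mulrA powR_sub2_mul// mulrC mulr_powRB1// (lt_trans ltr01).
Qed.

Definition bregman_density (R : realType) (p : R) (a b : R * R) : R :=
  p^-1 * enorm a `^ p - p^-1 * enorm b `^ p
  - enorm b `^ (p - 2) * dotp b (a - b).

(** Here b stands for the gradient of v and h for that of u - v. *)
Definition quasi_norm_density (R : realType) (p : R) (b h : R * R) : R :=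
  (enorm h + enorm b) `^ (p - 2) * enorm h ^+ 2.

Lemma bregman_densityE (R : realType) (p : R) (a b : R * R) : 1 < p ->
  bregman_density p a b = powR_gap p (enorm a) (enorm b)
    + enorm b `^ (p - 2) * (enorm a * enorm b - dotp a b).
Proof.
move=> p1; rewrite /bregman_density /powR_gap.
have -> : dotp b (a - b) = dotp a b - enorm b ^+ 2.
  by rewrite sqr_enorm /dotp /=; ring.
have b0 := enorm_ge0 b.
by rewrite mulrBr powR_sub2_sqr// -powR_sub2_mul//; ring.
Qed.

Lemma bregman_density_bounds (R : realType) (p : R) : 1 < p ->
  exists mu L : R, [/\ 0 < mu, 0 < L & forall a b : R * R,
    mu * quasi_norm_density p b (a - b) <= bregman_density p a b
      <= L * quasi_norm_density p b (a - b)].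
Proof.
move=> p1; have [mu [L [mu0 L0 H]]] := powR_bregman_bounds p1.
(* By the triangle inequality |a - b| + |b| and |a| + |b| differ by a factor of at most 2 either
   way. *)
set E : R := 2 `^ `|p - 2|; have E0 : 0 < E by exact: powR_gt0.
exists (mu / E), (L * E); split; [exact: divr_gt0|exact: mulr_gt0|move=> a b].
rewrite bregman_densityE// /quasi_norm_density.
have a0 := enorm_ge0 a; have b0 := enorm_ge0 b; have h0 := enorm_ge0 (a - b).
have hab := enormB_le a b; have ahb := enorm_leB a b.
have := normr_dotp_le a b; rewrite ler_norml => /andP[ab1 ab2].
(* The scalar bounds require s + t > 0. When both gradients vanish, every term is 0, also for p = 2,
   where 0^(p-2) = 1. *)
have [ab|ab0] := leP (enorm a + enorm b) 0.
  have -> : enorm a = 0 by lra.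
  have eb : enorm b = 0 by lra.
  have -> : dotp a b = 0 by move: ab1 ab2; rewrite eb; lra.
  have -> : enorm (a - b) = 0 by lra.
  have p0 : p != 0 by rewrite gt_eqF// (lt_trans ltr01).
  by rewrite eb /powR_gap expr0n/= (powR0 p0) !(mulr0, mul0r, subr0, addr0) lexx.
have w0 : 0 < enorm (a - b) + enorm b by lra.
have h1 : (enorm a + enorm b) `^ (p - 2)
    <= E * (enorm (a - b) + enorm b) `^ (p - 2).
  by apply: le_powR_comparable => //; rewrite ?ler1n//; lra.
have h2 : (enorm (a - b) + enorm b) `^ (p - 2)
    <= E * (enorm a + enorm b) `^ (p - 2).
  by apply: le_powR_comparable => //; rewrite ?ler1n//; lra.
have := H (enorm a) (enorm b) (enorm a * enorm b - dotp a b) a0 b0 _ _ ab0.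
have -> : (enorm a - enorm b) ^+ 2 + 2 * (enorm a * enorm b - dotp a b)
    = enorm (a - b) ^+ 2 by rewrite sqr_enormB; ring.
move=> /(_ _ _)/wrap[]; [by rewrite subr_ge0|by lra|].
move=> /andP[lo hi].
have hh : 0 <= enorm (a - b) ^+ 2 by exact: sqr_ge0.
apply/andP; split.
  apply: le_trans lo; rewrite -mulrA ler_pM2l// ler_pdivrMl// [leRHS]mulrA.
  exact: ler_wpM2r.
apply: (le_trans hi); rewrite -mulrA ler_pM2l// [leRHS]mulrA.
exact: ler_wpM2r.
Qed.

(** * Majorants and integrability *)

Lemma powR_add_le (R : realType) (p x y : R) :
  0 <= p -> 0 <= x -> 0 <= y -> (x + y) `^ p <= 2 `^ p * (x `^ p + y `^ p).
Proof.
move=> p0; wlog xy : x y / x <= y.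
  move=> H x0 y0; have [/H|/ltW/H] := leP x y; first exact.
  by rewrite addrC [x `^ p + _]addrC; apply.
move=> x0 y0; apply: (@le_trans _ _ ((2 * y) `^ p)).
  by apply: ge0_ler_powR; rewrite ?nnegrE ?addr_ge0 ?mulr_ge0//; lra.
by rewrite powRM// ler_wpM2l ?powR_ge0// lerDr powR_ge0.
Qed.

(** The majorant of the quasi-norm integrand. Enlarging x^2 to (x + y)^2 before anything else
    absorbs the possibly negative exponent p - 2. *)
Lemma powR_mul_sqr_le (R : realType) (p x y : R) : 1 < p -> 0 <= x -> 0 <= y ->
  (x + y) `^ (p - 2) * x ^+ 2 <= 2 `^ p * (x `^ p + y `^ p).
Proof.
move=> p1 x0 y0; apply: (@le_trans _ _ ((x + y) `^ p)).
  rewrite -[leRHS]powR_sub2_sqr ?addr_ge0// ler_wpM2l ?powR_ge0//.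
  by rewrite ler_pXn2r// ?nnegrE ?addr_ge0// lerDl.
by apply: powR_add_le => //; lra.
Qed.

(** The majorant of the integrand of the derivative: both factors are bounded by powers of x + y. *)
Lemma powR_pred_mul_le (R : realType) (p x y : R) : 1 < p -> 0 <= x -> 0 <= y ->
  x `^ (p - 1) * y <= 2 `^ p * (x `^ p + y `^ p).
Proof.
move=> p1 x0 y0; have p0 := lt_trans ltr01 p1.
apply: (@le_trans _ _ ((x + y) `^ p)); last by apply: powR_add_le => //; lra.
have q0 : 0 <= p - 1 by lra.
rewrite -(mulr_powRB1 _ p0) ?addr_ge0// [leRHS]mulrC.
apply: ler_pM; rewrite ?powR_ge0 ?lerDr//.
by apply: ge0_ler_powR => //; rewrite ?nnegrE ?addr_ge0 ?lerDl.
Qed.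

Section integrability.
Context {R : realType}.
Local Notation plane := (measurableTypeR R * measurableTypeR R)%type.
Implicit Types (p : R) (Omega : set (R * R)) (g : R * R -> R)
  (U : R * R -> R * R).

Lemma in_Lp_measurable p Omega g : open Omega -> in_Lp p Omega g ->
  measurable_fun (Omega : set plane) g.
Proof.
move=> oO gp; have mO := open_measurable2 oO.
apply/(measurable_restrictT _ _).2 => //.
by have := sub_Lfun_mfun gp; rewrite inE.
Qed.

Lemma in_Lp_integrable_powR p Omega g : 1 <= p -> open Omega ->
  in_Lp p Omega g -> leb2.-integrable Omega (EFin \o (fun z => `|g z| `^ p)).
Proof.
move=> p1 oO gp; have mO := open_measurable2 oO.
apply/integrable_mkcond => //.
have := Lfun_integrable p1 gp; apply: eq_integrable => // z _.
rewrite !patchE; case: ifPn => // _.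
by rewrite normr0 powR0// gt_eqF// (lt_le_trans ltr01).
Qed.

Lemma integrable_domination Omega g h : open Omega ->
  measurable_fun (Omega : set plane) g ->
  leb2.-integrable Omega (EFin \o h) -> (forall z, `|g z| <= h z) ->
  leb2.-integrable Omega (EFin \o g).
Proof.
move=> oO mg ih gh; apply: (le_integrable _ _ _ ih) => //.
- exact: open_measurable2.
- exact/measurable_EFinP.
- by move=> z _ /=; rewrite lee_fin (le_trans (gh z))// ler_norm.
Qed.

Lemma integrable_scaled_sum Omega (c : R) g h : open Omega ->
  leb2.-integrable Omega (EFin \o g) -> leb2.-integrable Omega (EFin \o h) ->
  leb2.-integrable Omega (EFin \o (fun z => c * (g z + h z))).
Proof.
move=> oO ig ih; have mO := open_measurable2 oO.
rewrite (_ : _ \o _ = fun z => (c%:E * ((g z)%:E + (h z)%:E))%E)//.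
by apply: integrableZl => //; exact: integrableD.
Qed.

(** Young's inequality bounds |f g| by |f|^q + |g|^p, once the factors 1/q and 1/p are estimated by
    1. *)
Lemma integrable_in_Lp_mul p q Omega f g : 1 < p -> p^-1 + q^-1 = 1 ->
  open Omega -> in_Lp q Omega f -> in_Lp p Omega g ->
  leb2.-integrable Omega (EFin \o (fun z => f z * g z)).
Proof.
move=> p1 pq oO fq gp.
have p0 := lt_trans ltr01 p1; have p1' := ltW p1.
have qE : q^-1 = 1 - p^-1 by rewrite -pq addrAC subrr add0r.
have pV1 : p^-1 < 1 by rewrite invf_lt1.
have pV0 : 0 < p^-1 by rewrite invr_gt0.
have q0 : 0 < q by rewrite -invr_gt0 qE subr_gt0.
have q1 : 1 <= q by rewrite -invf_le1// qE; lra.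
apply: (@integrable_domination _ _ (fun z => 1 * (`|f z| `^ q + `|g z| `^ p))) => //.
- apply: measurable_funM.
    exact: (in_Lp_measurable oO fq).
  exact: (in_Lp_measurable oO gp).
- by apply: integrable_scaled_sum => //; exact: in_Lp_integrable_powR.
move=> z; rewrite normrM mul1r.
have qp : q^-1 + p^-1 = 1 by rewrite addrC.
apply: (le_trans (conjugate_powR (normr_ge0 (f z)) (normr_ge0 (g z)) q0 p0 qp)).
by apply: lerD; rewrite ler_piMr ?powR_ge0// ?invf_le1// ltW.
Qed.

Definition in_Lp_field p Omega U :=
  in_Lp p Omega (fun z => (U z).1) /\ in_Lp p Omega (fun z => (U z).2).

Lemma in_Lp_fieldB p Omega U V : 1 <= p ->
  in_Lp_field p Omega U -> in_Lp_field p Omega V ->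
  in_Lp_field p Omega (fun z => U z - V z).
Proof.
move=> p1 [U1 U2] [V1 V2].
by split; [exact: (in_LpB p1 U1 V1)|exact: (in_LpB p1 U2 V2)].
Qed.

Lemma measurable_dotp p Omega U V : open Omega ->
  in_Lp_field p Omega U -> in_Lp_field p Omega V ->
  measurable_fun (Omega : set plane) (fun z => dotp (U z) (V z)).
Proof.
move=> oO [U1 U2] [V1 V2].
have m g : in_Lp p Omega g -> measurable_fun (Omega : set plane) g.
  exact: in_Lp_measurable.
by apply: measurable_funD; apply: measurable_funM; apply: m.
Qed.

Lemma measurable_enorm p Omega U : open Omega -> in_Lp_field p Omega U ->
  measurable_fun (Omega : set plane) (fun z => enorm (U z)).
Proof.
move=> oO UL.
(* The square root is written as a power so that measurability of [powR] applies. *)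
have -> : (fun z => enorm (U z)) = (fun z => dotp (U z) (U z) `^ 2^-1).
  by apply/funext => z; rewrite powR12_sqrt// -sqr_enorm sqr_ge0.
apply: (measurableT_comp (measurable_powR _)).
exact: (measurable_dotp oO UL UL).
Qed.

Lemma integrable_enorm_powR p Omega U : 1 <= p -> open Omega ->
  in_Lp_field p Omega U ->
  leb2.-integrable Omega (EFin \o (fun z => enorm (U z) `^ p)).
Proof.
move=> p1 oO UL; have [U1 U2] := UL; have p0 := le_trans ler01 p1.
apply: (@integrable_domination _ _
  (fun z => 2 `^ p * (`|(U z).1| `^ p + `|(U z).2| `^ p))) => //.
- exact: measurableT_comp (measurable_powR _) (measurable_enorm oO UL).
- by apply: integrable_scaled_sum => //; exact: in_Lp_integrable_powR.
move=> z; rewrite ger0_norm ?powR_ge0//.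
apply: le_trans (powR_add_le p0 (normr_ge0 _) (normr_ge0 _)).
by apply: ge0_ler_powR; rewrite ?nnegrE ?enorm_ge0 ?addr_ge0 ?enorm_le_add.
Qed.

Lemma integrable_quasi_norm_density p Omega U V : 1 < p -> open Omega ->
  in_Lp_field p Omega U -> in_Lp_field p Omega V ->
  leb2.-integrable Omega (EFin \o (fun z => quasi_norm_density p (V z) (U z))).
Proof.
move=> p1 oO UL VL; have p1' := ltW p1.
have mU := measurable_enorm oO UL; have mV := measurable_enorm oO VL.
apply: (@integrable_domination _ _
  (fun z => 2 `^ p * (enorm (U z) `^ p + enorm (V z) `^ p))) => //.
- apply: measurable_funM; last exact: measurable_funX.
  exact: measurableT_comp (measurable_powR _) (measurable_funD mU mV).
- by apply: integrable_scaled_sum => //; exact: integrable_enorm_powR.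
move=> z; rewrite /quasi_norm_density ger0_norm; last first.
  by rewrite mulr_ge0 ?powR_ge0 ?sqr_ge0.
by apply: powR_mul_sqr_le; rewrite ?enorm_ge0.
Qed.

(** By Cauchy-Schwarz the integrand is at most |V|^(p-1) |U| in absolute value. *)
Lemma integrable_flux p Omega U V : 1 < p -> open Omega ->
  in_Lp_field p Omega U -> in_Lp_field p Omega V ->
  leb2.-integrable Omega
    (EFin \o (fun z => enorm (V z) `^ (p - 2) * dotp (V z) (U z))).
Proof.
move=> p1 oO UL VL; have p1' := ltW p1.
apply: (@integrable_domination _ _
  (fun z => 2 `^ p * (enorm (V z) `^ p + enorm (U z) `^ p))) => //.
- apply: measurable_funM; last exact: (measurable_dotp oO VL UL).
  exact: measurableT_comp (measurable_powR _) (measurable_enorm oO VL).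
- by apply: integrable_scaled_sum => //; exact: integrable_enorm_powR.
move=> z; rewrite normrM (ger0_norm (powR_ge0 _ _)).
apply: le_trans (powR_pred_mul_le p1 (enorm_ge0 _) (enorm_ge0 _)).
rewrite -powR_sub2_mul ?enorm_ge0// -mulrA ler_wpM2l ?powR_ge0//.
exact: normr_dotp_le.
Qed.

(** * The Bregman distance as an integral *)

(** The load terms cancel because they are linear. Integrability of each summand justifies splitting
    the integral; that of the density is kept for the final comparison of integrals. *)
Lemma bregmanE p q Omega f (u v : fun_grad R) : 1 < p -> p^-1 + q^-1 = 1 ->
  open Omega -> in_Lp q Omega f -> W1p p Omega u -> W1p p Omega v ->
  leb2.-integrable Omega
    (EFin \o (fun z => bregman_density p (grad u z) (grad v z))) /\
  bregman p Omega f u v =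
    \int[leb2]_(z in Omega) bregman_density p (grad u z) (grad v z).
Proof.
move=> p1 pq oO fq [u0 ux uy _ _] [v0 vx vy _ _].
have p1' := ltW p1; have mO := open_measurable2 oO.
have UL : in_Lp_field p Omega (grad u) by split.
have VL : in_Lp_field p Omega (grad v) by split.
have iu := integrable_enorm_powR p1' oO UL.
have iv := integrable_enorm_powR p1' oO VL.
have iF := integrable_flux p1 oO (in_Lp_fieldB p1' UL VL) VL.
have ifu := integrable_in_Lp_mul p1 pq oO fq u0.
have ifv := integrable_in_Lp_mul p1 pq oO fq v0.
have iZ g : leb2.-integrable Omega (EFin \o g) ->
    leb2.-integrable Omega (EFin \o (fun z => p^-1 * g z)).
  move=> ig; rewrite (_ : _ \o _ = fun z => (p^-1%:E * (g z)%:E)%E)//.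
  exact: integrableZl.
have iB g h : leb2.-integrable Omega (EFin \o g) ->
    leb2.-integrable Omega (EFin \o h) ->
    leb2.-integrable Omega (EFin \o (fun z => g z - h z)).
  move=> ig ih; rewrite (_ : _ \o _ = fun z => ((g z)%:E - (h z)%:E)%E)//.
  exact: integrableB.
have iuv := iB _ _ (iZ _ iu) (iZ _ iv).
split; first exact: iB iuv iF.
rewrite /bregman_density (RintegralB mO iuv iF) (RintegralB mO (iZ _ iu) (iZ _ iv)).
rewrite (RintegralZl _ mO iu) (RintegralZl _ mO iv) /bregman /energy.
rewrite /energy_derivative.
have -> : \int[leb2]_(z in Omega) (f z * (u - v).1 z) =
    \int[leb2]_(z in Omega) (f z * u.1 z) - \int[leb2]_(z in Omega) (f z * v.1 z).
  rewrite -(RintegralB mO ifu ifv); apply: eq_Rintegral => z _.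
  by rewrite -mulrBr.
(* Subtraction of Sobolev pairs is pointwise on the gradient component, so this holds by
   computation. *)
rewrite -[grad (u - v)]/(fun z => grad u z - grad v z).
move: (\int[leb2]_(z in Omega) (enorm (grad u z) `^ p)) => Iu.
move: (\int[leb2]_(z in Omega) (enorm (grad v z) `^ p)) => Iv.
move: (\int[leb2]_(z in Omega) (enorm (grad v z) `^ (p - 2) *
  dotp (grad v z) (grad u z - grad v z))) => If.
move: (\int[leb2]_(z in Omega) (f z * u.1 z)) => Ifu.
move: (\int[leb2]_(z in Omega) (f z * v.1 z)) => Ifv.
ring.
Qed.
End integrability.

(** * Integration of the pointwise bounds *)

Unset Implicit Arguments.
Set Strict Implicit.

Theorem lemma3p3 (R : realType) (p : R) (hp : 1 < p) :
  exists mu L : R, [/\ 0 < mu, 0 < L &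
    forall (Omega : set (R * R)) (q : R) (f : R * R -> R) (u v : fun_grad R),
      polygonal_lipschitz_domain Omega ->
      p^-1 + q^-1 = 1 ->
      in_Lp q Omega f ->
      W1p p Omega u ->
      W1p p Omega v ->
      mu * quasi_norm2 p Omega v (u - v) <= bregman p Omega f u v
        <= L * quasi_norm2 p Omega v (u - v)].
Proof.
(* The constants are those of the pointwise bounds, fixed from p before the domain and the functions
   are introduced. *)
have [mu [L [mu0 L0 H]]] := bregman_density_bounds hp.
exists mu, L; split=> // Omega q f u v [[oO _ _ _] _] pq fq uW vW.
have [iD ->] := bregmanE hp pq oO fq uW vW.
have mO := open_measurable2 oO.
have UL : in_Lp_field p Omega (grad u) by case: uW.
have VL : in_Lp_field p Omega (grad v) by case: vW.
have iQ := integrable_quasi_norm_density hp oO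
  (in_Lp_fieldB (ltW hp) UL VL) VL.
have iZ c : leb2.-integrable Omega (EFin \o
    (fun z => c * quasi_norm_density p (grad v z) (grad u z - grad v z))).
  rewrite (_ : _ \o _ = fun z => (c%:E *
    (quasi_norm_density p (grad v z) (grad u z - grad v z))%:E)%E)//.
  exact: integrableZl.
rewrite -!(RintegralZl _ mO iQ).
by apply/andP; split; apply: le_Rintegral => // z _;
  have /andP[] := H (grad u z) (grad v z).
Qed.
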